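(* Let $0<q<1$, let $s\in\{0,\tfrac12,1,\tfrac32,\dots\}$, let $\ell\in\mathcal{J}_s$, and put $a=|s-\ell|$, $N=\min(2s,s+\ell)-|s-\ell|$. Let $X_1,X_2,S_1,S_2$ be the $(N+1)\times(N+1)$ matrices defined in the context ($S_1,S_2$ being invertible). Then the matrices $S_i$ satisfy the braid relation $$S_1S_2S_1=S_2S_1S_2.$$ Moreover, the tridiagonal matrix $X_2$ is related to the diagonal matrix $X_1$ by $$X_2=S_1S_2X_1S_2^{-1}S_1^{-1}=S_1^{-1}S_2^{-1}X_1S_2S_1.$$
   Context: Throughout $0<q<1$. For $s\in\{0,\frac12,1,\frac32,\dots\}$, $\mathcal{J}_s=\{j_{\min},j_{\min}+1,\dots,3s\}$ with $j_{\min}=0$ if $s$ is an integer and $j_{\min}=\frac12$ if $s$ is a half-integer (not an integer). For $\ell\in\mathcal{J}_s$, $a=|s-\ell|$ and $N=\min(2s,s+\ell)-|s-\ell|$ are nonnegative integers. Notation. $\chi_j=q^{2j+1}+q^{-2j-1}$. $\mathbb{I}_{N+1}$ is the identity matrix. Rows and columns of matrices are indexed by $0,1,\dots,N$. Matrices $X_1,X_2$. $X_1=\mathrm{diag}(\chi_a,\chi_{a+1},\dots,\chi_{a+N})$, and $X_2$ is the tridiagonal matrix with $(i,j)$ entry $\alpha_{i,j}$ for $|i-j|\le1$ and $0$ otherwise, where for $1\le j\le N$ $$\alpha_{j-1,j}=q^{-2a-1}\frac{(1-q^{2(j+a)})(1-q^{2(j+2a)})(1-q^{2(j-N-1)})(1-q^{2(j+3a+N+1)})}{(1-q^{2(2j+2a-1)})(1-q^{2(2j+2a)})},$$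 $$\alpha_{j,j-1}=q^{2a+1}\frac{(1-q^{2(j+a)})(1-q^{2j})(1-q^{2(j+2a+N+1)})(1-q^{2(j-a-N-1)})}{(1-q^{2(2j+2a)})(1-q^{2(2j+2a+1)})},$$ with $\alpha_{0,-1}=\alpha_{N,N+1}=0$, and for $0\le j\le N$, $\alpha_{j,j}=\chi_a-(\alpha_{j,j+1}+\alpha_{j,j-1})$. (These matrices represent the intermediate Casimir elements $C_{12}$ and $C_{23}$ of $U_q(\mathfrak{sl}_2)$ in the irreducible representation, labelled by $\ell$, of the centralizer of the diagonal action of $U_q(\mathfrak{sl}_2)$ on the threefold tensor power of its spin-$s$ representation. Both have eigenvalues $\chi_{a},\dots,\chi_{a+N}$, so $\prod_{j=0}^N(X_i-\chi_{a+j}\mathbb{I}_{N+1})=0$.) Matrices $S_1,S_2$. For $i=1,2$, $$S_i=\sum_{r=0}^N\gamma_rE_i^{(r)},\qquad E_i^{(r)}=\prod_{\substack{k=0\\k\ne r}}^N\frac{X_i-\chi_{a+k}\mathbb{I}_{N+1}}{\chi_{a+r}-\chi_{a+k}},\qquad \gamma_r=(-1)^rq^{r(r+2a+1)}.$$ The $E_i^{(r)}$, $r=0,\dots,N$, are orthogonal idempotents summing to $\mathbb{I}_{N+1}$, so $S_i$ is invertible with $S_i^{-1}=\sum_{r=0}^N\gamma_r^{-1}E_i^{(r)}$. *)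

(* Defs.v *)
From HB Require Import structures.
From mathcomp Require Import all_boot all_order all_algebra.
From mathcomp Require Import zify ring lra.

Set Implicit Arguments.
Unset Strict Implicit.
Unset Printing Implicit Defensive.

Import Order.TTheory GRing.Theory Num.Theory.

Local Open Scope ring_scope.

Definition is_spin (s : rat) : Prop := exists n : nat, s = n%:R / 2.

Definition jmin (s : rat) : rat := if s \is a Num.int then 0 else 1 / 2.

Definition in_J (s l : rat) : Prop :=
  (exists k : nat, l = jmin s + k%:R) /\ l <= 3 * s.

Section Matrices.
Variables (R : realFieldType) (q : R) (a N : nat).

Definition chi (j : nat) : R := q ^+ (2 * j + 1) + q ^- (2 * j + 1).

Definition omq (m : int) : R := 1 - q ^ (2 * m).

(* alpha_sup j is the entry (j-1, j) and alpha_sub j the entry (j, j-1); both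
   vanish outside 1 <= j <= N, which covers alpha_{N,N+1} = alpha_{0,-1} = 0. *)
Definition alpha_sup (j : nat) : R :=
  if (1 <= j <= N)%N then
    q ^ (- (2 * a%:Z) - 1)
    * (omq (j%:Z + a%:Z) * omq (j%:Z + 2 * a%:Z) * omq (j%:Z - N%:Z - 1)
       * omq (j%:Z + 3 * a%:Z + N%:Z + 1))
    / ((1 - q ^ (2 * (2 * j%:Z + 2 * a%:Z - 1))) * omq (2 * j%:Z + 2 * a%:Z))
  else 0.

Definition alpha_sub (j : nat) : R :=
  if (1 <= j <= N)%N then
    q ^ (2 * a%:Z + 1)
    * (omq (j%:Z + a%:Z) * omq j%:Z * omq (j%:Z + 2 * a%:Z + N%:Z + 1)
       * omq (j%:Z - a%:Z - N%:Z - 1))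
    / (omq (2 * j%:Z + 2 * a%:Z) * omq (2 * j%:Z + 2 * a%:Z + 1))
  else 0.

Definition X1 : 'M[R]_N.+1 := diag_mx (\row_(j < N.+1) chi (a + j)).

Definition X2 : 'M[R]_N.+1 :=
  \matrix_(i < N.+1, j < N.+1)
    if j == i.+1 :> nat then alpha_sup j
    else if i == j.+1 :> nat then alpha_sub i
    else if i == j then chi a - (alpha_sup i.+1 + alpha_sub i)
    else 0.

Definition gam (r : nat) : R := (-1) ^+ r * q ^+ (r * (r + 2 * a + 1)).

Definition idem (X : 'M[R]_N.+1) (r : 'I_N.+1) : 'M[R]_N.+1 :=
  \prod_(k < N.+1 | k != r)
    ((chi (a + r) - chi (a + k))^-1 *: (X - (chi (a + k))%:M)).

Definition Smx (X : 'M[R]_N.+1) : 'M[R]_N.+1 :=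
  \sum_(r < N.+1) gam r *: idem X r.

Definition S1 : 'M[R]_N.+1 := Smx X1.
Definition S2 : 'M[R]_N.+1 := Smx X2.

End Matrices.

Lemma jmin_spin (s : rat) : is_spin s -> exists m : nat, s = jmin s + m%:R.
Proof.
move=> [n ->].
have -> : n%:R = (odd n)%:R + n./2%:R * 2 :> rat.
  by rewrite -natrM -natrD muln2 odd_double_half.
case: (odd n); exists n./2; last first.
  have -> : (false%:R + n./2%:R * 2) / 2 = n./2%:R :> rat by rewrite /=; lra.
  by rewrite /jmin (natr_int _ n./2) add0r.
rewrite /jmin; case: ifP => [/intrP[z hz]|_]; last by rewrite /=; lra.
have /intr_inj : (1 + 2 * n./2%:Z)%:~R = (2 * z)%:~R :> rat.
  by rewrite intrD !intrM -hz /=; lra.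
lia.
Qed.

(* |s - l| and min (2s, s + l) - |s - l| are indeed natural numbers. *)
Lemma in_J_nat (s l : rat) : is_spin s -> in_J s l ->
  exists a N : nat,
    a%:R = `|s - l| /\ N%:R = Num.min (2 * s) (s + l) - `|s - l|.
Proof.
move=> hs [[k hk] hl]; have [m hm] := jmin_spin hs.
have [e he] : exists e : nat, 2 * jmin s = e%:R.
  by rewrite /jmin; case: ifP => _; [exists 0%N | exists 1%N]; rewrite ?mulr0 //; lra.
have hle : (k%:R : rat) <= (e + 3 * m)%:R by rewrite natrD natrM; lra.
rewrite ler_nat in hle.
case: (leqP m k) => hmk.
  have hmk' : (m%:R : rat) <= k%:R by rewrite ler_nat.
  exists (k - m)%N, (e + 3 * m - k)%N.
  rewrite ler0_norm; last by lra.
  rewrite min_l; last by lra.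
  by rewrite !natrB // natrD natrM; split; lra.
have hmk' : (k%:R : rat) <= m%:R by rewrite ler_nat ltnW.
exists (m - k)%N, (e + 2 * k)%N.
rewrite ger0_norm; last by lra.
rewrite min_r; last by lra.
by rewrite natrB 1?ltnW // natrD natrM; split; lra.
Qed.

(* Main.v *)
Require Import Defs.
From mathcomp Require Import all_boot all_order all_algebra.
From mathcomp Require Import zify ring lra.

Set Implicit Arguments.
Unset Strict Implicit.
Unset Printing Implicit Defensive.

Import Order.TTheory GRing.Theory Num.Theory.

Local Open Scope ring_scope.

(** The braid relation and the two conjugation formulas come from a duality
    that exchanges X1 and X2, together with one explicit conjugation by S1.

    Duality.  Put x = q^(2i).  The rows of X2 act on functions of i as a
    second-order q-difference operator (the q-Racah one), and X1 acts as
    multiplication by chi_(a+i).  On the q-Pochhammer basis phi_k both are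
    bidiagonal with diagonal chi_a, ..., chi_(a+N): X2 is upper bidiagonal
    ([X2_Pmx], resting on [phi_difference_eq]) and X1 is lower bidiagonal
    ([X1_Pmx], resting on [phi_multiplication_eq]).  All off-diagonal entries
    are nonzero, so a diagonal rescaling K turns the first bidiagonal matrix
    into the transpose of the second ([B2_Kmx]).  Hence U = P K P^T, with P the
    matrix of the phi_k, satisfies X2 U = U X1 and X1 U = U X2^T: the pair
    (X2, X1) is similar to the pair (X1, X2^T).  As S2 is the same polynomial in
    X2 as S1 is in X1, also S2 U = U S1.

    Explicit conjugation.  S1 is diagonal with entries gamma_j.  Write
      [X, Y]_q = (q^-1 X Y - q Y X) / (q^2 - q^-2) + c,
    the expression giving the third intermediate Casimir element from two of
    them ([twist] below).  Entry by entry, T S1 = S1 [X1, T]_q holds for every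
    tridiagonal T with diagonal entries C / (chi_(a+i) + q + q^-1), where the
    constant C is tied to c ([tridiag_twist]).  X2 has such a diagonal
    ([maindiagM]), so this covers X2 and X2^T.

    Transporting the relation for X2^T through U gives the same relations for
    the pair (X2, X1), so that
      S1^-1 X2 S1 = [X1, X2]_q = S2 X1 S2^-1,
      S1 X2 S1^-1 = [X2, X1]_q = S2^-1 X1 S2,
    which are the two formulas for X2.  In particular conjugation by S1 S2
    carries X1 to X2; as S1 and S2 are the same polynomial in X1 and in X2, it
    carries S1 to S2, and this is the braid relation. *)

(** * Rational identities for the q-difference operator *)

Section Rational.
Variables (F : fieldType) (q A M : F).

(** chi_(a+i) as a function of x = q^(2i), with A = q^(2a). *)
Definition chiX (x : F) : F := x * A * q + (x * A * q)^-1.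

(** The entries (i, i+1), (i, i-1) and (i, i) of X2 as functions of x = q^(2i),
    with A = q^(2a) and M = q^(2N).  In alpha_sup the quotient of
    1 - q^(2(j+a)) by 1 - q^(2(2j+2a)) has been simplified to
    1 / (1 + q^(2(j+a))), and likewise in alpha_sub; the denominators then stay
    nonzero at i = 0, and the boundary conditions alpha_(0,-1) = 0 and
    alpha_(N,N+1) = 0 become the zeros of subdiag at i = 0 and of supdiag at
    i = N. *)
Definition supdiag (x : F) : F :=
  (1 - x * q ^+ 2 * A ^+ 2) * (1 - x / M) * (1 - x * q ^+ 4 * A ^+ 3 * M)
  / ((1 - (x * A * q) ^+ 2) * (1 + x * A * q ^+ 2)) / (q * A).

Definition subdiag (x : F) : F :=
  q * A * ((1 - x) * (1 - x * A ^+ 2 * M * q ^+ 2) * (1 - x / (A * M * q ^+ 2)))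
  / ((1 + x * A) * (1 - (x * A * q) ^+ 2)).

Definition maindiag (x : F) : F := chiX 1 - (supdiag x + subdiag x).

Definition diag_const : F :=
  (1 + A) * (1 + q ^+ 2 * A * M) * (1 + q ^+ 2 * A ^+ 2 * M)
  / (q ^+ 2 * A ^+ 2 * M).

(** The off-diagonal coefficients, at y = q^(2k), of multiplication by chi and
    of the q-difference operator on the basis phi. *)
Definition split_low (y : F) : F := - (y * q * A)^-1.

Definition split_up (y : F) : F :=
  (1 - y^-1) * (1 - y * A) * (1 - y / (q ^+ 2 * M))
  * (1 - y * q ^+ 2 * A ^+ 3 * M) / (q * A).

(** (q^(-2i); q^2)_k (q^(2i+4a+2); q^2)_k at x = q^(2i): a polynomial of degree k
    in chi_(a+i), vanishing for i < k. *)
Definition phi (k : nat) (x : F) : F :=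
  \prod_(m < k) ((1 - q ^+ (2 * m) / x) * (1 - q ^+ (2 * m) * q ^+ 2 * A ^+ 2 * x)).

Hypotheses (q0 : q != 0) (A0 : A != 0) (M0 : M != 0).

(** This collapse of the diagonal of X2 to a constant over chi + q + q^-1 is
    what lets the q-commutator with X1 act on the diagonal as conjugation by S1
    does, namely trivially. *)
Lemma maindiagM x : x != 0 -> 1 + x * A != 0 -> 1 + x * A * q ^+ 2 != 0 ->
  1 - (x * A * q) ^+ 2 != 0 ->
  maindiag x * (chiX x + (q + q^-1)) = diag_const.
Proof.
move=> x0 h1 h2 h3; rewrite /maindiag /diag_const /supdiag /subdiag /chiX.
by field; rewrite ?q0 ?A0 ?M0 ?x0 ?h1 ?h2 ?h3 /=.
Qed.

Lemma expq2S k : q ^+ (2 * k.+1) = q ^+ (2 * k) * q ^+ 2.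
Proof. by rewrite mulnSr exprD. Qed.

Lemma phiS k x : phi k.+1 x =
  phi k x * ((1 - q ^+ (2 * k) / x) * (1 - q ^+ (2 * k) * q ^+ 2 * A ^+ 2 * x)).
Proof. by rewrite /phi big_ord_recr. Qed.

(** Shifting x by q^2 moves one factor between the two q-Pochhammer symbols.
    The factors on the left-hand sides here and in [phi_shift_down] are exactly
    those that supdiag and subdiag provide, so no division is needed at the
    ends of the range of i. *)
Lemma phi_shift_up k x : x != 0 ->
  phi k.+1 (q ^+ 2 * x) * (1 - x * A ^+ 2 * q ^+ 2) =
  phi k x * ((1 - (q ^+ 2 * x)^-1) * (1 - q ^+ (2 * k) * q ^+ 2 * A ^+ 2 * x)
             * (1 - q ^+ (2 * k) * q ^+ 4 * A ^+ 2 * x)).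
Proof.
move=> x0; elim: k => [|k IH].
  by rewrite phiS /phi !big_ord0 !mul1r; field; rewrite q0 x0.
rewrite phiS mulrAC IH phiS !expq2S.
by field; rewrite q0 x0.
Qed.

Lemma phi_shift_down k x : x != 0 ->
  phi k.+1 (x / q ^+ 2) * (1 - x^-1) =
  phi k x * ((1 - x * A ^+ 2) * (1 - q ^+ (2 * k) / x)
             * (1 - q ^+ (2 * k) * q ^+ 2 / x)).
Proof.
move=> x0; elim: k => [|k IH].
  by rewrite phiS /phi !big_ord0 !mul1r; field; rewrite q0 x0.
rewrite phiS mulrAC IH phiS !expq2S.
by field; rewrite q0 x0.
Qed.

(** After the shifts are expressed through phi k x, all terms are multiples of
    it and a rational identity in x and q^(2k) remains. *)
Lemma phi_difference_eq k x : x != 0 -> 1 + x * A != 0 -> 1 + x * A * q ^+ 2 != 0 ->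
  1 - (x * A * q) ^+ 2 != 0 ->
  supdiag x * phi k.+1 (q ^+ 2 * x) + subdiag x * phi k.+1 (x / q ^+ 2)
    + maindiag x * phi k.+1 x =
  chiX (q ^+ (2 * k.+1)) * phi k.+1 x + split_up (q ^+ (2 * k.+1)) * phi k x.
Proof.
move=> x0 h1 h2 h3.
(* Split off from supdiag and subdiag the factors absorbed by the shifts. *)
have -> : supdiag x * phi k.+1 (q ^+ 2 * x) =
  (1 - x / M) * (1 - x * q ^+ 4 * A ^+ 3 * M)
  / ((1 - (x * A * q) ^+ 2) * (1 + x * A * q ^+ 2)) / (q * A)
  * (phi k.+1 (q ^+ 2 * x) * (1 - x * A ^+ 2 * q ^+ 2)).
  by rewrite /supdiag; field; rewrite q0 A0 M0 h2 h3.
have -> : subdiag x * phi k.+1 (x / q ^+ 2) =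
  - x * (q * A * ((1 - x * A ^+ 2 * M * q ^+ 2) * (1 - x / (A * M * q ^+ 2))))
  / ((1 + x * A) * (1 - (x * A * q) ^+ 2))
  * (phi k.+1 (x / q ^+ 2) * (1 - x^-1)).
  by rewrite /subdiag; field; rewrite q0 A0 M0 x0 h1 h3.
rewrite phi_shift_up // phi_shift_down // phiS.
rewrite /split_up /maindiag /supdiag /subdiag /chiX !expq2S.
have := expf_neq0 (2 * k) q0; set y := q ^+ (2 * k) => y0.
by field; rewrite ?q0 ?A0 ?M0 ?x0 ?y0 ?h1 ?h2 ?h3.
Qed.

Lemma phi_multiplication_eq k x : x != 0 ->
  chiX x * phi k x =
  chiX (q ^+ (2 * k)) * phi k x + split_low (q ^+ (2 * k)) * phi k.+1 x.
Proof.
move=> x0; rewrite phiS /split_low /chiX.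
have := expf_neq0 (2 * k) q0; set y := q ^+ (2 * k) => y0.
by field; rewrite q0 A0 x0 y0.
Qed.

End Rational.

(** * The entries of X2 *)

Section Braid.
Variables (R : realFieldType) (q : R) (hq : 0 < q < 1) (a N : nat).

Local Notation A := (q ^+ (2 * a)).
Local Notation M := (q ^+ (2 * N)).
Local Notation x i := (q ^+ (2 * i)).
Local Notation X1 := (X1 q a N).
Local Notation X2 := (X2 q a N).

Let q_gt0 : 0 < q. Proof. by case/andP: hq. Qed.
Let q_lt1 : q < 1. Proof. by case/andP: hq. Qed.
Let q_neq0 : q != 0. Proof. exact: lt0r_neq0. Qed.
Let qX_neq0 n : q ^+ n != 0. Proof. exact: expf_neq0. Qed.

Let qX_lt1 n : (0 < n)%N -> q ^+ n < 1.
Proof. by move=> n0; rewrite exprn_ilt1 ?ltW // -lt0n. Qed.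

Let onemqX n : (0 < n)%N -> 1 - q ^+ n != 0.
Proof. by move=> n0; rewrite subr_eq0 gt_eqF ?qX_lt1. Qed.

Let onepqX n : 1 + q ^+ n != 0.
Proof. by rewrite lt0r_neq0 // addr_gt0 // exprn_gt0. Qed.

Let den1 i : 1 + x i * A != 0.
Proof. by rewrite -exprD onepqX. Qed.

Let den2 i : 1 + x i * A * q ^+ 2 != 0.
Proof. by rewrite -!exprD onepqX. Qed.

Let den3 i : 1 - (x i * A * q) ^+ 2 != 0.
Proof. by rewrite -exprD -exprSr -exprM onemqX. Qed.

Lemma chi_chiX i : chi q (a + i) = chiX q A (x i).
Proof.
rewrite /chi /chiX; suff -> : x i * A * q = q ^+ (2 * (a + i) + 1) by [].
by rewrite mulnDr !exprD expr1; ring.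
Qed.

Lemma expz_monomial i (z : int) (ei ea eN e da dN d : nat) :
  z + (2 * a * da + 2 * N * dN + d)%:Z
    = (2 * i * ei + 2 * a * ea + 2 * N * eN + e)%:Z ->
  q ^ z = x i ^+ ei * A ^+ ea * M ^+ eN * q ^+ e / (A ^+ da * M ^+ dN * q ^+ d).
Proof.
rewrite -!exprM -!exprD; set m := (_ + d)%N; set n := (_ + e)%N => h.
have -> : z = n%:Z - m%:Z by lia.
by rewrite expfzDr // -exprnN.
Qed.

Lemma alpha_supE i : (i <= N)%N -> alpha_sup q a N i.+1 = supdiag q A M (x i).
Proof.
move=> hi; rewrite /alpha_sup ltn0Sn /=; case: ifP => [hlt|hge]; last first.
  have -> : i = N by lia.
  by rewrite /supdiag divff // subrr !(mul0r, mulr0).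
rewrite /supdiag /omq.
rewrite (@expz_monomial i _ 0 0 0 0 1 0 1); last lia.
rewrite (@expz_monomial i _ 1 1 0 2 0 0 0); last lia.
rewrite (@expz_monomial i _ 1 2 0 2 0 0 0); last lia.
rewrite (@expz_monomial i _ 1 0 0 0 0 1 0); last lia.
rewrite (@expz_monomial i _ 1 3 1 4 0 0 0); last lia.
rewrite (@expz_monomial i _ 2 2 0 2 0 0 0); last lia.
rewrite (@expz_monomial i _ 2 2 0 4 0 0 0); last lia.
have h3 := den3 i; have h2 := den2 i.
have h4 : 1 - x i * A * q ^+ 2 != 0 by rewrite -!exprD addn2 onemqX.
have := qX_neq0 (2 * i); have := qX_neq0 (2 * a); have := qX_neq0 (2 * N).
move: h3 h2 h4; move: (x i) A M => y B L h3 h2 h4 L0 B0 y0.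
have h5 : 1 - (y * B) ^+ 2 * q ^+ 4 != 0.
  rewrite (_ : _ - _ = (1 - y * B * q ^+ 2) * (1 + y * B * q ^+ 2)); last ring.
  by rewrite mulf_neq0.
by field; rewrite ?q_neq0 ?B0 ?y0 ?L0 ?h2 ?h3 ?h5.
Qed.

Lemma alpha_subE i : (i <= N)%N -> alpha_sub q a N i = subdiag q A M (x i).
Proof.
case: i => [_|i hi]; first by rewrite /subdiag expr0 subrr !(mul0r, mulr0).
rewrite /alpha_sub hi /subdiag /omq /=.
rewrite (@expz_monomial i _ 0 1 0 1 0 0 0); last lia.
rewrite (@expz_monomial i.+1 _ 1 1 0 0 0 0 0); last lia.
rewrite (@expz_monomial i.+1 _ 1 0 0 0 0 0 0); last lia.
rewrite (@expz_monomial i.+1 _ 1 2 1 2 0 0 0); last lia.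
rewrite (@expz_monomial i.+1 _ 1 0 0 0 1 1 2); last lia.
rewrite (@expz_monomial i.+1 _ 2 2 0 0 0 0 0); last lia.
rewrite (@expz_monomial i.+1 _ 2 2 0 2 0 0 0); last lia.
have h3 := den3 i.+1; have h2 := den1 i.+1.
have h4 : 1 - x i.+1 * A != 0 by rewrite -!exprD onemqX.
have := qX_neq0 (2 * i.+1); have := qX_neq0 (2 * a); have := qX_neq0 (2 * N).
move: h3 h2 h4; move: (x i.+1) A M => y B L h3 h2 h4 L0 B0 y0.
have h5 : 1 - (y * B) ^+ 2 != 0.
  by rewrite (_ : _ - _ = (1 - y * B) * (1 + y * B)) ?mulf_neq0 //; ring.
by field; rewrite ?q_neq0 ?B0 ?y0 ?L0 ?h2 ?h3 ?h5.
Qed.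

Lemma sum_if_eq_ord n m (G : nat -> R) :
  \sum_(j < n) (if j == m :> nat then G j else 0) =
  if (m < n)%N then G m else 0.
Proof. by rewrite -big_mkcond /= big_ord1_eq. Qed.

(** With i.-1 = 0 at i = 0 the middle term meets the diagonal, harmlessly
    because subdiag is zero there. *)
Lemma X2E (i j : 'I_N.+1) : X2 i j =
  (if j == i.+1 :> nat then supdiag q A M (x i) else 0)
  + (if j == i.-1 :> nat then subdiag q A M (x i) else 0)
  + (if j == i :> nat then maindiag q A M (x i) else 0).
Proof.
have hi : (i <= N)%N by rewrite -ltnS.
have dn0 : i = 0%N :> nat -> subdiag q A M (x i) = 0.
  by move=> ->; rewrite /subdiag expr0 subrr !(mul0r, mulr0).
rewrite mxE /maindiag -[chiX _ _ 1]/(chiX q A (x 0)) -chi_chiX addn0.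
rewrite -alpha_supE // -alpha_subE // -[i == j]val_eqE /= [j == i :> nat]eq_sym.
rewrite -alpha_subE // in dn0.
case: eqP => [->|n1].
  by rewrite !ifN ?addr0 //; lia.
rewrite add0r; case: eqP => [e|n2].
  have -> : (j == i.-1 :> nat) by lia.
  by rewrite ifN ?addr0 //; lia.
case: eqP => [e|n3]; last by rewrite ifN ?addr0 //; lia.
case: eqP => [e'|n4]; rewrite ?add0r // dn0 ?add0r //; lia.
Qed.

Lemma X2_mul (i : 'I_N.+1) (G : nat -> R) :
  \sum_j X2 i j * G j =
  supdiag q A M (x i) * G i.+1 + subdiag q A M (x i) * G i.-1
  + maindiag q A M (x i) * G i.
Proof.
have hi : (i <= N)%N by rewrite -ltnS.
pose U m := supdiag q A M (x i) * G m; pose V m := subdiag q A M (x i) * G m.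
pose W m := maindiag q A M (x i) * G m.
rewrite (eq_bigr (fun j : 'I_N.+1 =>
   (if j == i.+1 :> nat then U j else 0) + (if j == i.-1 :> nat then V j else 0)
   + (if j == i :> nat then W j else 0))); last first.
  by move=> j _; rewrite X2E !mulrDl; do 3 case: ifP => _; rewrite ?mul0r.
rewrite !big_split !sum_if_eq_ord /=.
rewrite ltn_ord (leq_ltn_trans (leq_pred i)) //; congr (_ + _ + _).
case: ifP => // hiN; have -> : nat_of_ord i = N by lia.
by rewrite /supdiag divff // subrr !(mul0r, mulr0).
Qed.

(** * The split basis and the duality exchanging X1 and X2 *)

Definition Pmx : 'M[R]_N.+1 := \matrix_(i, k) phi q A k (x i).

Definition B1 : 'M[R]_N.+1 := \matrix_(j, k)
  ((if j == k :> nat then chi q (a + k) else 0)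
   + (if j == k.+1 :> nat then split_low q A (x k) else 0)).

(** For k = 0 the second condition reads j = 0, where the coefficient split_up
    is zero. *)
Definition B2 : 'M[R]_N.+1 := \matrix_(j, k)
  ((if j == k :> nat then chi q (a + k) else 0)
   + (if j == k.-1 :> nat then split_up q A M (x k) else 0)).

Lemma split_up0 : split_up q A M (x 0) = 0.
Proof. by rewrite /split_up expr0 invr1 subrr !mul0r. Qed.

Lemma phi_eq0 k i : (i < k)%N -> phi q A k (x i) = 0.
Proof.
move=> hik; rewrite /phi (bigD1 (Ordinal hik)) //=.
by rewrite divff // subrr !mul0r.
Qed.

Lemma X2_Pmx : X2 *m Pmx = Pmx *m B2.
Proof.
apply/matrixP=> i k; rewrite !mxE.
under eq_bigr => j _ do rewrite [Pmx _ _]mxE.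
rewrite (X2_mul i (fun j => phi q A k (x j))).
under [RHS]eq_bigr => j _ do rewrite !mxE mulrDr !(fun_if (fun z => _ * z)) mulr0.
rewrite big_split /= (sum_if_eq_ord _ k (fun m => phi q A m (x i) * chi q (a + k))).
rewrite (sum_if_eq_ord _ k.-1 (fun m => phi q A m (x i) * split_up q A M (x k))).
rewrite ltn_ord (leq_ltn_trans (leq_pred k)) //.
case: k => -[|k] hk /=.
  by rewrite split_up0 /phi !big_ord0 /maindiag chi_chiX expr0; ring.
rewrite chi_chiX.
have xS : x i.+1 = q ^+ 2 * x i by rewrite expq2S mulrC.
have -> : subdiag q A M (x i) * phi q A k.+1 (x i.-1)
        = subdiag q A M (x i) * phi q A k.+1 (x i / q ^+ 2).
  case: (nat_of_ord i) => [|j] /=; last by rewrite expq2S mulfK.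
  by rewrite /subdiag expr0 subrr !(mul0r, mulr0).
by rewrite xS phi_difference_eq //; ring.
Qed.

Lemma X1_Pmx : X1 *m Pmx = Pmx *m B1.
Proof.
apply/matrixP=> i k; rewrite mul_diag_mx !mxE.
under eq_bigr => j _ do rewrite !mxE mulrDr !(fun_if (fun z => _ * z)) mulr0.
rewrite big_split /= (sum_if_eq_ord _ k (fun m => phi q A m (x i) * chi q (a + k))).
rewrite (sum_if_eq_ord _ k.+1 (fun m => phi q A m (x i) * split_low q A (x k))) ltn_ord.
rewrite !chi_chiX phi_multiplication_eq // [_ * chiX _ _ _]mulrC; congr (_ + _).
rewrite mulrC; case: ifP => // hk.
by rewrite phi_eq0 ?mul0r //; have := ltn_ord i; lia.
Qed.

Lemma Pmx_unit : Pmx \in unitmx.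
Proof.
rewrite unitmxE det_trig; last first.
  by apply/is_trig_mxP=> i j hij; rewrite mxE phi_eq0.
rewrite unitfE; apply/prodf_neq0 => i _; rewrite mxE.
apply/prodf_neq0 => m _; rewrite mulf_neq0 //.
  have -> : x i = x m * q ^+ (2 * (i - m)).
    by rewrite -exprD -mulnDr subnKC // ltnW.
  by rewrite invfM mulrA divff // mul1r subr_eq0 lt_eqF // invf_gt1 ?exprn_gt0 //
    qX_lt1 // muln_gt0 subn_gt0 /=.
by rewrite -exprM -!exprD onemqX //; lia.
Qed.

(** The bidiagonal form of X2 has no zero on its superdiagonal up to N: the
    factor with 1 - q^(2(k-N-1)) first vanishes at k = N+1. *)
Lemma split_up_neq0 k : (0 < k <= N)%N -> split_up q A M (x k) != 0.
Proof.
move=> /andP[k0 kN].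
have i1 n m : (n != m)%N -> 1 - q ^+ n / q ^+ m != 0.
  case: (ltngtP n m) => // h _; last first.
    by rewrite -expfB // onemqX ?subn_gt0.
  rewrite -invf_div -expfB // subr_eq0 lt_eqF // invf_gt1 ?exprn_gt0 //.
  by rewrite qX_lt1 ?subn_gt0.
rewrite /split_up !mulf_neq0 ?invr_neq0 ?mulf_neq0 //.
- by have := i1 0%N (2 * k)%N; rewrite expr0 mul1r; apply; lia.
- by rewrite -exprD onemqX //; lia.
- by rewrite -exprD i1 //; lia.
- by rewrite -exprM -!exprD onemqX //; lia.
Qed.

Lemma split_low_neq0 y : y != 0 -> split_low q A y != 0.
Proof. by move=> y0; rewrite oppr_eq0 invr_neq0 // !mulf_neq0. Qed.

(** The unique diagonal rescaling, up to a scalar, that exchanges the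
    superdiagonal of B2 with the subdiagonal of B1. *)
Definition Kmx : 'M[R]_N.+1 :=
  diag_mx (\row_k \prod_(m < k) (split_low q A (x m) / split_up q A M (x m.+1))).

Lemma Kmx_unit : Kmx \in unitmx.
Proof.
rewrite unitmxE det_diag unitfE; apply/prodf_neq0 => k _; rewrite mxE.
apply/prodf_neq0 => m _; rewrite mulf_neq0 ?split_low_neq0 ?invr_neq0 ?split_up_neq0 //=.
have := ltn_ord k; have := ltn_ord m; lia.
Qed.

Lemma B2_Kmx : B2 *m Kmx = Kmx *m B1^T.
Proof.
apply/matrixP=> j k; rewrite mul_mx_diag mul_diag_mx !mxE.
have -> : (j == k :> nat) = (k == j :> nat) by rewrite eq_sym.
have [e|n1] := eqVneq (k : nat) j.
  have -> : (k == j.+1 :> nat) = false by lia.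
  rewrite e addr0 mulrC; case: eqP => [e'|]; last by rewrite addr0.
  by rewrite (_ : nat_of_ord j = 0%N) ?split_up0 ?addr0 //; lia.
rewrite !add0r; case: eqP => [e|n2]; last by rewrite ifN ?mul0r ?mulr0 //; lia.
have hk : nat_of_ord k = j.+1 by lia.
rewrite hk eqxx big_ord_recr /=.
by field; rewrite split_up_neq0 //= -hk -ltnS.
Qed.

Definition Umx : 'M[R]_N.+1 := Pmx *m Kmx *m Pmx^T.

Lemma Umx_unit : Umx \in unitmx.
Proof. by rewrite !unitmx_mul unitmx_tr Pmx_unit Kmx_unit. Qed.

Lemma X1_tr : X1^T = X1. Proof. exact: tr_diag_mx. Qed.

(** X2 P K P^T = P B2 K P^T = P K (P B1)^T = P K (X1 P)^T, and X1 is
    symmetric. *)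
Lemma X2_Umx : X2 *m Umx = Umx *m X1.
Proof.
rewrite /Umx !mulmxA X2_Pmx -(mulmxA Pmx) B2_Kmx mulmxA -[LHS]mulmxA -trmx_mul.
by rewrite -X1_Pmx trmx_mul X1_tr mulmxA.
Qed.

(** The same computation with the transposed relation between B1 and B2; X2 is
    not symmetric, whence its transpose. *)
Lemma X1_Umx : X1 *m Umx = Umx *m X2^T.
Proof.
have B1K : B1 *m Kmx = Kmx *m B2^T.
  by apply: trmx_inj; rewrite !trmx_mul trmxK tr_diag_mx B2_Kmx.
rewrite /Umx !mulmxA X1_Pmx -(mulmxA Pmx) B1K mulmxA -[LHS]mulmxA -trmx_mul.
by rewrite -X2_Pmx trmx_mul mulmxA.
Qed.

(** * The q-commutator and conjugation by S1 *)

Definition kappa : R := q ^+ 2 - q ^- 2.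

(** Forced by the diagonal case of [tridiag_twist]: there the q-commutator part
    multiplies the entry by - chi / (q + q^-1). *)
Definition twist_const : R := diag_const q A M / (q + q^-1).

Definition twist (X Y : 'M[R]_N.+1) : 'M[R]_N.+1 :=
  kappa^-1 *: (q^-1 *: (X *m Y) - q *: (Y *m X)) + twist_const%:M.

Lemma twist_tr X Y : (twist X Y)^T = twist Y^T X^T.
Proof.
by rewrite /twist linearD linearZ linearB !linearZ /= !trmx_mul tr_scalar_mx.
Qed.

Lemma twist_conj (X Y X' Y' U : 'M[R]_N.+1) :
  X *m U = U *m X' -> Y *m U = U *m Y' -> twist X Y *m U = U *m twist X' Y'.
Proof.
move=> hX hY; rewrite /twist mulmxDl mulmxDr -!scalemxAl -!scalemxAr.
rewrite mulmxBl mulmxBr -!scalemxAl -!scalemxAr scalar_mxC.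
by rewrite -!mulmxA hX hY !mulmxA hX hY.
Qed.

Lemma Smx_conj (X X' U : 'M[R]_N.+1) :
  X *m U = U *m X' -> Smx q a X *m U = U *m Smx q a X'.
Proof.
move=> hX; rewrite /Smx mulmx_suml mulmx_sumr; apply: eq_bigr => r _.
rewrite -scalemxAl -scalemxAr; congr (_ *: _); rewrite /idem.
apply: (big_rec2 (fun E E' => E *m U = U *m E')).
  by rewrite mul1mx mulmx1.
move=> k E E' _ hE.
rewrite -!mulmxE -mulmxA hE !mulmxA -scalemxAl -scalemxAr; congr (_ *m _).
by rewrite mulmxBl mulmxBr hX scalar_mxC.
Qed.

Lemma chi_inj : injective (chi q).
Proof.
have E n : chi q n = q ^+ (2 * n + 1) + (q ^+ (2 * n + 1))^-1 by [].
move=> m n; rewrite !E => h; apply/eqP; apply: contraT => hmn.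
have : (q ^+ (2 * m + 1) - q ^+ (2 * n + 1))
       * (1 - (q ^+ (2 * m + 1) * q ^+ (2 * n + 1))) = 0.
  move: h; have := qX_neq0 (2 * m + 1); have := qX_neq0 (2 * n + 1).
  move: (q ^+ (2 * m + 1)) (q ^+ (2 * n + 1)) => v u u0 v0 h.
  have -> : (v - u) * (1 - v * u) = - v * u * (v + v^-1 - (u + u^-1)).
    by field; rewrite u0 v0.
  by rewrite h subrr mulr0.
move/eqP; rewrite mulf_eq0 -exprD (negPf (onemqX _)) ?orbF; last lia.
rewrite subr_eq0; case: (ltngtP m n) hmn => // hmn _.
  by rewrite gt_eqF // ltr_iXn2l //; lia.
by rewrite lt_eqF // ltr_iXn2l //; lia.
Qed.

(** The matrices idem X r are Lagrange interpolation polynomials in X at the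
    nodes chi_(a+k), hence Smx X takes chi_(a+j) to gam j. *)
Lemma Smx_eigen (X : 'M[R]_N.+1) (v : 'cV[R]_N.+1) (j : 'I_N.+1) :
  X *m v = chi q (a + j) *: v -> Smx q a X *m v = gam q a j *: v.
Proof.
move=> hX; rewrite /Smx mulmx_suml.
have E (r : 'I_N.+1) : idem q a X r *m v = (j == r)%:R *: v.
  transitivity ((\prod_(k < N.+1 | k != r)
    ((chi q (a + r) - chi q (a + k))^-1
     * (chi q (a + j) - chi q (a + k)))) *: v).
    rewrite /idem.
    apply: (big_rec2 (fun (E : 'M[R]_N.+1) z => E *m v = z *: v)).
      by rewrite mul1mx scale1r.
    move=> k E z _ hE.
    rewrite -mulmxE -mulmxA hE -scalemxAr -scalemxAl mulmxBl hX mul_scalar_mx.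
    by rewrite -scalerBl !scalerA; congr (_ *: _); ring.
  congr (_ *: _); case: eqVneq => [->|njr]; last first.
    by rewrite (bigD1 j) //= subrr mulr0 mul0r.
  rewrite big1 // => k nkr; rewrite mulVf // subr_eq0.
  apply: contra nkr => /eqP/chi_inj/eqP; rewrite eqn_add2l => /eqP e.
  by apply/eqP/val_inj.
rewrite (bigD1 j) //= -scalemxAl E eqxx scale1r big1 ?addr0 // => r nrj.
by rewrite -scalemxAl E eq_sym (negPf nrj) scale0r scaler0.
Qed.

Lemma Smx_X1 : Smx q a X1 = diag_mx (\row_j gam q a j).
Proof.
apply/matrixP=> i j.
have hX : X1 *m (delta_mx j 0 : 'cV_N.+1) = chi q (a + j) *: delta_mx j 0.
  apply/matrixP=> k l; rewrite mul_diag_mx !mxE.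
  by case: eqP => [->|]; rewrite ?mulr0.
have /matrixP/(_ i 0) := Smx_eigen hX; rewrite -colE !mxE => ->.
by rewrite eqxx andbT; case: eqP => [->|]; rewrite ?mulr1 ?mulr0.
Qed.

Lemma chiE n : chi q n = x n * q + (x n * q)^-1.
Proof. by rewrite /chi addn1 exprSr. Qed.

Lemma gamS m : gam q a m.+1 = - gam q a m * q ^+ (2 * (a + m)) * q ^+ 2.
Proof.
have e : (m.+1 * (m.+1 + 2 * a + 1) = m * (m + 2 * a + 1) + (2 * (a + m) + 2))%N.
  by lia.
by rewrite /gam e !exprD exprS; ring.
Qed.

Lemma gam_neq0 m : gam q a m != 0.
Proof. by rewrite mulf_neq0 // signr_eq0. Qed.

Lemma kappa_neq0 : kappa != 0.
Proof.
have -> : kappa = (q ^+ 4 - 1) / q ^+ 2 by rewrite /kappa; field.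
by rewrite mulf_neq0 ?invr_neq0 // -oppr_eq0 opprB onemqX.
Qed.

(** The ratio of consecutive gam is, up to the factor kappa, the coefficient
    with which the q-commutator with X1 multiplies an entry next to the
    diagonal. *)
Lemma gamS_kappa m :
  gam q a m.+1 * kappa
  = gam q a m * (q^-1 * chi q (a + m) - q * chi q (a + m.+1)).
Proof.
rewrite gamS !chiE /kappa addnS expq2S.
by have := qX_neq0 (2 * (a + m)); move: (q ^+ (2 * _)) => y y0; field; rewrite q_neq0.
Qed.

Lemma gam_kappa m :
  gam q a m * kappa
  = gam q a m.+1 * (q^-1 * chi q (a + m.+1) - q * chi q (a + m)).
Proof.
rewrite gamS !chiE /kappa addnS expq2S.
by have := qX_neq0 (2 * (a + m)); move: (q ^+ (2 * _)) => y y0; field; rewrite q_neq0.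
Qed.

(** Conjugating by the diagonal matrix S1 rescales the entry (i, j) by
    gam j / gam i, while the twist rescales it by an expression in chi_(a+i) and
    chi_(a+j) only.  The two agree for |i - j| = 1 by the recursion of gam, and
    on the diagonal by the choice of twist_const. *)
Lemma tridiag_twist (T : 'M[R]_N.+1) :
  (forall i j : 'I_N.+1, j != i -> j != i.+1 :> nat -> i != j.+1 :> nat ->
     T i j = 0) ->
  (forall i, T i i * (chi q (a + i) + (q + q^-1)) = diag_const q A M) ->
  T *m Smx q a X1 = Smx q a X1 *m twist X1 T.
Proof.
move=> hoff hdiag; apply/matrixP=> i j.
have k0 := kappa_neq0.
have p0 : q + q^-1 != 0 by rewrite lt0r_neq0 // addr_gt0 // invr_gt0.
rewrite Smx_X1 mul_mx_diag mul_diag_mx /twist mul_diag_mx mul_mx_diag.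
rewrite !mxE; have [e|nij] := eqVneq i j.
  rewrite -e mulrC; congr (_ * _); rewrite mulr1n /twist_const -(hdiag i) /kappa.
  field; rewrite q_neq0 -expr2 -exprM addrC onepqX.
  by rewrite -oppr_eq0 opprB onemqX.
rewrite !mulr0n addr0; apply: (mulIf k0).
have -> : gam q a i * (kappa^-1 * (q^-1 * (chi q (a + i) * T i j)
    - q * (T i j * chi q (a + j)))) * kappa
  = T i j * (gam q a i * (q^-1 * chi q (a + i) - q * chi q (a + j))).
  by field; rewrite k0 q_neq0.
rewrite -mulrA; have [e1|n1] := eqVneq (j : nat) i.+1; first by rewrite e1 gamS_kappa.
have [e2|n2] := eqVneq (i : nat) j.+1; first by rewrite e2 gam_kappa.
by rewrite hoff ?mul0r // eq_sym.
Qed.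

Lemma X2_S1_twist (T : 'M[R]_N.+1) : T = X2 \/ T = X2^T ->
  T *m Smx q a X1 = Smx q a X1 *m twist X1 T.
Proof.
move=> hT; apply: tridiag_twist.
  have h (i j : 'I_N.+1) : j != i -> j != i.+1 :> nat -> i != j.+1 :> nat ->
      X2 i j = 0.
    move=> n1 n2 n3; rewrite mxE (negPf n2) (negPf n3) ifN //.
    by rewrite eq_sym.
  case: hT => -> i j n1 n2 n3; first exact: h.
  by rewrite mxE h // eq_sym.
have h (i : 'I_N.+1) : X2 i i * (chi q (a + i) + (q + q^-1)) = diag_const q A M.
  have -> : X2 i i = maindiag q A M (x i).
    rewrite X2E eqxx ifN ?add0r; last lia.
    case: eqP => [e|_]; last by rewrite add0r.
    have -> : nat_of_ord i = 0%N by lia.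
    by rewrite {1}/subdiag expr0 subrr !(mul0r, mulr0) add0r.
  by rewrite chi_chiX maindiagM.
by case: hT => -> i; last rewrite mxE; apply: h.
Qed.

(** * Braid relation *)

Lemma S1_unit : S1 q a N \is a GRing.unit.
Proof.
rewrite -[_ \is a _]/(_ \in unitmx) /S1 Smx_X1 unitmxE det_diag unitfE.
by apply/prodf_neq0 => i _; rewrite mxE gam_neq0.
Qed.

Lemma S2_Umx : S2 q a N *m Umx = Umx *m S1 q a N.
Proof. exact: Smx_conj X2_Umx. Qed.

Lemma S2_unit : S2 q a N \is a GRing.unit.
Proof.
have -> : S2 q a N = Umx * S1 q a N * Umx^-1.
  by rewrite -[Umx * _]S2_Umx mulrK // Umx_unit.
by rewrite unitrMl ?unitrV ?Umx_unit // unitrMl ?S1_unit ?Umx_unit.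
Qed.

Lemma X2_S1 : X2 * S1 q a N = S1 q a N * twist X1 X2.
Proof. by apply: X2_S1_twist; left. Qed.

Lemma S1_tr : (S1 q a N)^T = S1 q a N.
Proof. by rewrite /S1 Smx_X1 tr_diag_mx. Qed.

Lemma S1_X2 : S1 q a N * X2 = twist X2 X1 * S1 q a N.
Proof.
apply: trmx_inj; rewrite !trmx_mul S1_tr twist_tr X1_tr.
by apply: X2_S1_twist; right.
Qed.

(** The relation between X1 and X2^T, carried through U. *)
Lemma X1_S2 : X1 * S2 q a N = S2 q a N * twist X2 X1.
Proof.
apply: (can_inj (mulmxK Umx_unit)); rewrite -!mulmxE -!mulmxA S2_Umx.
rewrite (twist_conj X2_Umx X1_Umx) [LHS]mulmxA X1_Umx -mulmxA.
by rewrite (X2_S1_twist (or_intror erefl)) [RHS]mulmxA S2_Umx; apply: mulmxA.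
Qed.

Lemma S2_X1 : S2 q a N * X1 = twist X1 X2 * S2 q a N.
Proof.
have h : S1 q a N *m X2^T = twist X2^T X1 *m S1 q a N.
  by apply: trmx_inj; rewrite !trmx_mul S1_tr twist_tr X1_tr trmxK; apply: X2_S1.
apply: (can_inj (mulmxK Umx_unit)); rewrite -!mulmxE -!mulmxA S2_Umx.
rewrite X1_Umx mulmxA S2_Umx -mulmxA h mulmxA -(twist_conj X1_Umx X2_Umx).
by symmetry; apply: mulmxA.
Qed.

Lemma X2_conj : X2 * (S1 q a N * S2 q a N) = S1 q a N * S2 q a N * X1.
Proof. by rewrite mulrA X2_S1 -!mulrA S2_X1. Qed.

Lemma X1_conj : X1 * (S2 q a N * S1 q a N) = S2 q a N * S1 q a N * X2.
Proof. by rewrite mulrA X1_S2 -!mulrA S1_X2. Qed.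

(** S1 S2 intertwines X1 and X2, hence also S1 = Smx X1 and S2 = Smx X2. *)
Lemma S1S2_braid : S1 q a N * S2 q a N * S1 q a N = S2 q a N * S1 q a N * S2 q a N.
Proof. by symmetry; rewrite -[LHS]mulrA; apply: Smx_conj X2_conj. Qed.

End Braid.

Theorem proposition3p2 (R : realFieldType) (q : R) (hq : 0 < q < 1)
    (s l : rat) (hs : is_spin s) (hl : in_J s l)
    (a N : nat) (ha : a%:R = `|s - l|)
    (hN : N%:R = Num.min (2 * s) (s + l) - `|s - l|) :
  let X1 := X1 q a N in let X2 := X2 q a N in
  let S1 := S1 q a N in let S2 := S2 q a N in
  [/\ S1 \is a GRing.unit, S2 \is a GRing.unit,
      S1 * S2 * S1 = S2 * S1 * S2,
      X2 = S1 * S2 * X1 * S2^-1 * S1^-1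
    & X2 = S1^-1 * S2^-1 * X1 * S2 * S1].
Proof.
have u1 := S1_unit hq a N; have u2 := S2_unit hq a N.
split=> //; first exact: S1S2_braid.
  by rewrite -X2_conj // mulrA !mulrK.
by rewrite -!mulrA X1_conj // -!mulrA !mulKr.
Qed.
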